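(* Let $I=[0,1]$ or $I=[0,\infty)$ and let $X$ be a Banach function space on $I$ such that the abstract Cesàro function space $CX$ is nontrivial (i.e. $CX\ne\{0\}$). Then $CX$ contains an order asymptotically isometric copy of $\ell^1$.
   Context: $L^0(I)$ is the space of (a.e. equivalence classes of) real-valued Lebesgue measurable functions on $I$. A Banach function space $X$ on $I$ is a Banach space that is a linear subspace of $L^0(I)$ with the ideal property: $|f|\le|g|$ a.e., $f\in L^0(I)$, $g\in X$ imply $f\in X$ and $\|f\|_X\le\|g\|_X$; by convention $X$ is also assumed to contain a function positive a.e. on $I$ (this is not assumed for the derived space $CX$). Cesàro operator: $Cf(x)=\frac1x\int_0^x f(t)\,dt$ for $0<x\in I$. $CX=\{f\in L^0(I): C|f|\in X\}$ with norm $\|f\|_{CX}=\|C|f|\|_X$. A space $E\subset L^0(I)$ with the ideal property and complete norm contains an order asymptotically isometric copy of $\ell^1$ if there are a sequence $(f_n)\subset E$ with pairwise disjoint supports and a sequence $(\varepsilon_n)\subset(0,1)$ with $\varepsilon_n\to0$ such that $\sum_{n=1}^\infty(1-\varepsilon_n)|\alpha_n|\le\left\|\sum_{n=1}^\infty\alpha_nf_n\right\|_E\le\sum_{n=1}^\infty|\alpha_n|$ for each $(\alpha_n)\in\ell^1$. *)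

(* Defs.v *)
From HB Require Import structures.
From mathcomp Require Import all_boot all_order all_algebra.
From mathcomp Require Import all_classical all_reals all_analysis.

Set Implicit Arguments.
Unset Strict Implicit.
Unset Printing Implicit Defensive.

Import Order.TTheory GRing.Theory Num.Theory.
Import numFieldNormedType.Exports.

Local Open Scope classical_set_scope.
Local Open Scope ring_scope.

(* Measurability, "almost everywhere" and integrals refer to the (complete)
   Lebesgue sigma-algebra, i.e. the Caratheodory sigma-algebra of Lebesgue outer
   measure, and not to the Borel sets on which [lebesgue_measure] lives. *)
Notation lebesgueType R :=
  (caratheodory_type ((@wlength R idfun)^*)%mu).
Notation leb R := (@completed_lebesgue_measure R).

(* Functions on I are represented by functions on R of which only the values on
   I matter; elements of L^0(I) are handled through representatives. *)
Definition ae_on (R : realType) (I : set R) (P : R -> Prop) : Prop :=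
  \forall x \ae leb R, I x -> P x.

Definition L0 (R : realType) (I : set R) : set (R -> R) :=
  [set f | measurable_fun (I : set (lebesgueType R))
             (f : lebesgueType R -> R)].

(* A candidate normed space of functions: the set of representatives of its
   elements, and its norm (whose values outside [fcarrier] are irrelevant). *)
Record fspace (R : realType) := FSpace {
  fcarrier :> (R -> R) -> Prop;
  fnorm : (R -> R) -> R }.

(* Banach spaces contained in L^0(I) with the ideal property. Invariance under
   a.e. equality of both the carrier and the norm is part of [bi_ideal]. *)
Record is_banach_ideal_space (R : realType) (I : set R) (E : fspace R) : Prop :=
  BanachIdealSpace {
  bi_L0 : forall f, E f -> L0 I f;
  bi_zero : E (cst 0);
  bi_add : forall f g, E f -> E g -> E (f \+ g);
  bi_scale : forall (a : R) f, E f -> E (a \*o f);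
  bi_norm_eq0 : forall f, E f -> fnorm E f = 0 -> ae_on I (fun x => f x = 0);
  bi_normZ : forall (a : R) f, E f -> fnorm E (a \*o f) = `|a| * fnorm E f;
  bi_normD : forall f g, E f -> E g ->
    fnorm E (f \+ g) <= fnorm E f + fnorm E g;
  bi_ideal : forall f g, L0 I f -> E g -> ae_on I (fun x => `|f x| <= `|g x|) ->
    E f /\ fnorm E f <= fnorm E g;
  bi_complete : forall u : nat -> R -> R, (forall n, E (u n)) ->
    (forall e, 0 < e -> exists N : nat, forall m n : nat,
      (N <= m)%N -> (N <= n)%N -> fnorm E (u m \- u n) < e) ->
    exists2 f, E f & fnorm E (u n \- f) @[n --> \oo] --> (0 : R) }.

Definition is_banach_function_space (R : realType) (I : set R) (X : fspace R)
    : Prop :=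
  is_banach_ideal_space I X /\ exists2 w, X w & ae_on I (fun x => 0 < w x).

Definition fspace_nontrivial (R : realType) (I : set R) (E : fspace R) : Prop :=
  exists2 f, E f & ~ ae_on I (fun x => f x = 0).

(* Extended-real valued, since [C|f|] makes sense for every measurable [f].
   Only the values at x > 0 are meaningful. *)
Definition cesaro_op (R : realType) (f : R -> R) (x : R) : \bar R :=
  ((x^-1)%:E * \int[leb R]_(t in `[0%R, x]) (f t)%:E)%E.

Definition cesaro_abs (R : realType) (f : R -> R) : R -> \bar R :=
  cesaro_op (fun t => `|f t|).

(* [C|f|] belongs to X, as an element of L^0(I), iff it is finite a.e. on I and
   its real-valued version belongs to X. *)
Definition cesaro_space (R : realType) (I : set R) (X : fspace R) : fspace R :=
  FSpace
    [set f | [/\ L0 I f,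
                 ae_on I (fun x => cesaro_abs f x \is a fin_num) &
                 X (fine \o cesaro_abs f)]]
    (fun f => fnorm X (fine \o cesaro_abs f)).

(* The sum of the series of alpha_n f_n is its limit for the norm of E. *)
Definition is_norm_sum (R : realType) (E : fspace R) (u : nat -> R -> R)
    (s : R -> R) : Prop :=
  E s /\
  fnorm E (fun x => (\sum_(0 <= k < n) u k x) - s x) @[n --> \oo] --> (0 : R).

Definition has_order_asymptotic_l1 (R : realType) (I : set R) (E : fspace R)
    : Prop :=
  exists (f : nat -> R -> R) (eps : nat -> R),
    [/\ forall n, E (f n),
        forall m n, m != n -> ae_on I (fun x => f m x = 0 \/ f n x = 0),
        forall n, 0 < eps n < 1,
        eps n @[n --> \oo] --> (0 : R) &
        forall alpha : nat -> R, cvgn (series (fun n => `|alpha n|)) ->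
          exists2 s, is_norm_sum E (fun n x => alpha n * f n x) s &
            limn (series (fun n => (1 - eps n) * `|alpha n|)) <= fnorm E s
              <= limn (series (fun n => `|alpha n|))].

(* Main.v *)
Require Import Defs.
From mathcomp Require Import all_boot all_order all_algebra.
From mathcomp Require Import all_classical all_reals all_analysis.
From mathcomp Require Import measurable_realfun.

(** The Cesaro operator forgets how mass is distributed: to the right of its
    support, the transform of a nonnegative function is its total mass divided
    by [x]. Let [h_a] be the transform of the unit point mass at [a], that is
    [1/x] for [x >= a] and [0] before [a], and let [phi a] be its norm in [X].

    If the Cesaro space contains a nonzero function, then the ideal property
    puts [h_a] in [X] for some [a] in the interior of [I]
    ([cesaro_dirac_mem]). From there on [phi] is positive, up to the right end
    of [I] ([cesaro_dirac_norm_gt0]), and nonincreasing, since [h_a] decreases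
    when [a] increases. A monotone function has points of continuity, so there
    are a point [b] and a sequence [t_k] that increases strictly and stays below
    [b], with [phi (t_k)] tending to [phi b] ([incr_seq_continuity]).

    Let [g_k] be the normalised indicator of [[t_k, t_(k+1)[], of integral one.
    For a summable sequence [c], the transform of [sum |c_k| g_k] equals
    [sum |c_k|] times [h_b] beyond [b], and it is at most [sum |c_k| h_(t_k)]
    everywhere. Hence, in the Cesaro space,

      [(sum |c_k|) phi b <= || sum c_k g_k || <= sum |c_k| phi (t_k)]

    ([cesaro_norm_box_series_ge], [cesaro_norm_box_series_le]). With
    [c_k = alpha_k / phi (t_k)] the right-hand side is [sum |alpha_k|] and the
    left-hand side is [sum (phi b / phi (t_k)) |alpha_k|], whose weights tend to
    one. The functions [g_k / phi (t_k)] are therefore as required; the second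
    inequality, applied to remainders, also gives the convergence of the series
    in norm. *)

Import Order.TTheory GRing.Theory Num.Theory.
Import numFieldNormedType.Exports.

Local Open Scope classical_set_scope.
Local Open Scope ring_scope.

Set Implicit Arguments.
Unset Strict Implicit.

(** * Continuity points of monotone functions *)

(** Monotone functions have countably many jumps, and an interval is not
    countable since its measure is positive. *)
Lemma nondecreasing_left_continuity_point (R : realType) (F : R -> R)
    (a d : R) :
  a < d -> nondecreasing_fun F ->
  exists2 b, a < b < d & F x @[x --> b^'-] --> F b.
Proof.
move=> ad ndF.
have [b [bad ctsb]] : exists b, (b \in `]a, d[) /\ ~ discontinuity F b.
  apply: contrapT => /forallNP H.
  have : countable (`]a, d[%classic : set R).
    rewrite (_ : (`]a, d[%classic : set R) =
        [set x | (x \in `]a, d[) /\ discontinuity F x]).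
      by apply: discontinuity_countable => x y _ _; exact: ndF.
    apply/seteqP; split => x /=; last by case.
    by move=> xad; split => //; apply: contrapT => nd; apply: (H x).
  move=> /countable_lebesgue_measure0.
  rewrite lebesgue_measure_itv/= lte_fin ad => /eqP.
  by rewrite -EFinB eqe subr_eq0 gt_eqF.
have cl : cvg (F x @[x --> b^'-]).
  apply: nondecreasing_at_left_is_cvgr.
    by apply: nearW => x y z _ _; exact: ndF.
  apply: nearW => x; exists (F b) => _ /= [y xyb <-]; apply: ndF.
  by move: xyb; rewrite in_itv/= => /andP[_ /ltW].
have cr : cvg (F x @[x --> b^'+]).
  apply: nondecreasing_at_right_is_cvgr.
    by apply: nearW => x y z _ _; exact: ndF.
  apply: nearW => x; exists (F b) => _ /= [y xyb <-]; apply: ndF.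
  by move: xyb; rewrite in_itv/= => /andP[/ltW].
have lim_eq : lim (F x @[x --> b^'-]) = lim (F x @[x --> b^'+]).
  by apply/eqP; apply: contrapT => /negP ne; apply: ctsb; split.
exists b; first by move: bad; rewrite in_itv.
suff -> : F b = lim (F x @[x --> b^'-]) by [].
apply/eqP; rewrite eq_le; apply/andP; split.
  rewrite lim_eq; apply: limr_ge => //; near=> x; apply: ndF.
  by near: x; exact: nbhs_right_ge.
apply: limr_le => //; near=> x; apply: ndF.
by near: x; exact: nbhs_left_le.
Unshelve. all: by end_near. Qed.

(** This is what allows the norms of the Cesaro transforms of point masses at
    [t k] to converge to the norm at the limit [b] of the sequence [t]. *)
Lemma incr_seq_continuity (R : realType) (F : R -> R) (a d : R) :
  a < d -> {in `[a, d] &, nonincreasing_fun F} ->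
  exists (b : R) (t : nat -> R),
    [/\ b < d, a < t 0%N, forall k, t k < t k.+1, forall k, t k < b &
        F (t k) @[k --> \oo] --> F b].
Proof.
move=> ad niF.
(* Clamping makes the function monotone on the whole line. *)
pose G x := - F (Num.max a (Num.min x d)).
have G_nd : nondecreasing_fun G.
  move=> x y xy; rewrite lerN2; apply: niF.
  - by rewrite in_itv/= le_max lexx/= ge_max (ltW ad) ge_min lexx orbT.
  - by rewrite in_itv/= le_max lexx/= ge_max (ltW ad) ge_min lexx orbT.
  - by rewrite ge_max !le_max lexx/= le_min !ge_min xy lexx !orbT.
have [b /andP[ab bd] Gb] := nondecreasing_left_continuity_point ad G_nd.
have ba : 0 < b - a by rewrite subr_gt0.
(* Starting at k.+2 keeps [t 0] to the right of [a]. *)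
pose t k := b - (b - a) * k.+2%:R^-1.
have tb k : t k < b by rewrite ltrBlDr ltrDl mulr_gt0 ?invr_gt0.
have t_incr k : t k < t k.+1.
  by rewrite ltrD2l ltrN2 ltr_pM2l// ltf_pV2 ?posrE// ltr_nat.
have at_ k : a < t k.
  rewrite /t ltrBrDr addrC -ltrBrDr -[ltRHS]mulr1 ltr_pM2l//.
  by rewrite invf_lt1// ltr1n.
exists b, t; split => //.
have tcv : t k @[k --> \oo] --> b.
  rewrite -[X in _ --> X](subr0 b) -[X in _ - X](mulr0 (b - a)).
  apply: cvgB; first exact: cvg_cst.
  apply: cvgM; first exact: cvg_cst.
  by have := @cvg_harmonic R; rewrite -(cvg_shiftn 1);
    under eq_fun do rewrite addn1.
have GE x : a <= x -> x <= d -> G x = - F x.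
  by move=> ax xd; rewrite /G min_l// max_r.
rewrite -[F b]opprK -GE ?(ltW ab) ?(ltW bd)//.
rewrite (_ : (fun k => F (t k)) = (fun k => - G (t k))); last first.
  apply/funext => k.
  by rewrite GE ?opprK ?(ltW (at_ k))// ltW// (lt_trans (tb k)).
by apply: cvgN; apply: (cvg_at_leftP _ _ _).1 Gb _ _.
Qed.

(** * Real series *)

Lemma series_single_cvg (R : realType) (u : nat -> R) (k0 : nat) :
  (forall k, k != k0 -> u k = 0) -> series u n @[n --> \oo] --> u k0.
Proof.
move=> u0; apply: cvg_near_cst; near=> n.
have k0n : (k0 < n)%N by near: n; exists k0.+1.
rewrite /series/= big_mkord (bigD1 (Ordinal k0n))//= big1 ?addr0// => i ik0.
by apply: u0; apply: contraNneq ik0 => ik0; apply/eqP/val_inj.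
Unshelve. all: by end_near. Qed.

Lemma series_tail_cvg (R : realType) (u : nat -> R) (l : R) (n : nat) :
  series u m @[m --> \oo] --> l ->
  series (fun k => if (k < n)%N then 0 else u k) m @[m --> \oo] -->
    l - series u n.
Proof.
move=> ul; have : series u m - series u n @[m --> \oo] --> l - series u n.
  by apply: cvgB => //; exact: cvg_cst.
apply: cvg_trans; apply: near_eq_cvg; near=> m.
have nm : (n <= m)%N by near: m; exists n.
rewrite sub_series_geq// [RHS]/series/= (big_cat_nat (leq0n n) nm)/=.
rewrite [X in _ = X + _]big1_seq ?add0r; last first.
  by move=> k; rewrite mem_index_iota /= => ->.
by apply: eq_big_nat => k /andP[nk _]; rewrite ltnNge nk.
Unshelve. all: by end_near. Qed.

(** * The completed Lebesgue measure *)

Lemma borel_lebesgue_measurable (R : realType) (A : set R) :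
  measurable A -> measurable (A : set (lebesgueType R)).
Proof. exact: sub_caratheodory. Qed.

Lemma borel_lebesgue_measurable_fun (R : realType) (D : set R) (f : R -> R) :
  measurable_fun D f -> measurable D -> L0 D f.
Proof.
move=> mf mD _ B mB; apply: borel_lebesgue_measurable; exact: mf.
Qed.

Lemma leb_itv (R : realType) (i : interval R) :
  leb R [set` i] = (if i.1 < i.2 then (i.2 : \bar R) - i.1 else 0)%E.
Proof. exact: lebesgue_measure_itv. Qed.

#[local] Instance leb_ae_filter (R : realType) :
  Filter (nbhs (almost_everywhere (leb R))).
Proof. exact: (@ae_filter_ringOfSetsType _ (lebesgueType R)). Qed.

Lemma ae_neq (R : realType) (y : R) : \forall x \ae leb R, x != y.
Proof.
exists [set y]; split.
- exact: borel_lebesgue_measurable.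
- exact: lebesgue_measure_set1.
- by move=> x /= /negP; rewrite negbK => /eqP.
Qed.

(** * Cesaro transforms of point masses and of boxes *)

Local Notation "\int_ x f" := (\int[leb _]_(y in `[0%R, x]) (f y)%:E)%E
  (at level 10, x at level 0, f at level 9).

Section cesaro_integral.
Context {R : realType}.
Implicit Types (f : R -> R) (a b x : R).

Definition box a b x : R := (b - a)^-1 * \1_(`[a, b[ : set R) x.

(** The Cesaro transform of the unit point mass at [a]. *)
Definition cesaro_dirac a x : R := (a <= x)%R%:R * x^-1.

(** Inversion is only piecewise monotone. Cut off at a positive level it becomes
    nonincreasing on the whole line, hence measurable, and this suffices for
    functions that vanish to the left of that level. *)
Lemma measurable_inv_max a : 0 < a ->
  measurable_fun setT (fun x => (Num.max x a)^-1).
Proof.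
move=> a0; apply: nonincreasing_measurable => // x y xy.
have mx z : 0 < Num.max z a by rewrite lt_max a0 orbT.
by rewrite lef_pV2 ?posrE// ge_max le_max xy/= le_max lexx orbT.
Qed.

Lemma measurable_cesaro_dirac (D : set R) a : 0 < a -> L0 D (cesaro_dirac a).
Proof.
move=> a0; apply: (@measurable_funTS _ _ (lebesgueType R)).
rewrite (_ : cesaro_dirac a =
    fun x => (a <= x)%R%:R * (Num.max x a)^-1); last first.
  by apply/funext => x; rewrite /cesaro_dirac; case: leP => //; rewrite !mul0r.
apply: borel_lebesgue_measurable_fun => //; apply: measurable_funM.
  apply: nondecreasing_measurable => // x y xy.
  by have [ax|//] := leP a x; rewrite (le_trans ax xy).
exact: measurable_inv_max.
Qed.

Lemma measurable_box (D : set R) a b : L0 D (box a b).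
Proof.
apply: (@measurable_funTS _ _ (lebesgueType R)).
by apply: borel_lebesgue_measurable_fun => //; exact: measurable_funM.
Qed.

Lemma box_ge0 a b x : a < b -> 0 <= box a b x.
Proof. by move=> ab; rewrite mulr_ge0// invr_ge0 subr_ge0 ltW. Qed.

Lemma lebesgueType_itv (i : interval R) :
  measurable ([set` i] : set (lebesgueType R)).
Proof. by apply: borel_lebesgue_measurable; exact: measurable_itv. Qed.

Lemma integral_box a b x : a < b ->
  \int_ x (box a b) = ((b - a)^-1%:E * leb R (`[a, b[ `&` `[0%R, x]))%E.
Proof.
move=> ab; under eq_integral do rewrite /box EFinM.
rewrite ge0_integralZl_EFin; last first.
- by rewrite invr_ge0 subr_ge0 ltW.
- apply/measurable_EFinP; apply: measurable_funTS; apply: measurable_indic.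
  exact: lebesgueType_itv.
- by move=> y _; rewrite lee_fin.
- exact: lebesgueType_itv.
- by rewrite integral_indic//; exact: lebesgueType_itv.
Qed.

(** The two bounds below say that a box of mass one on [[a, b[] is seen by the
    Cesaro operator as a point mass, up to an error located in [[a, b[]: its
    primitive lies between the jumps at [b] and at [a]. *)
Lemma integral_box_le a b x : a < b ->
  (\int_ x (box a b) <= (a <= x)%R%:R%:E)%E.
Proof.
move=> ab; rewrite integral_box//.
have ba : 0 < b - a by rewrite subr_gt0.
have [ax|xa] := leP a x; last first.
  rewrite (_ : _ `&` _ = set0) ?measure0 ?mule0//.
  apply/seteqP; split => // y []/=; rewrite !in_itv/= => /andP[ay _] /andP[_].
  by move=> /(le_trans ay); rewrite leNgt xa.
apply: (@le_trans _ _ ((b - a)^-1%:E * leb R (`[a, b[))%E).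
  rewrite lee_wpmul2l ?lee_fin ?invr_ge0 ?(ltW ba)//.
  apply: le_measure => //; rewrite ?inE.
  - by apply: measurableI; exact: lebesgueType_itv.
  - exact: lebesgueType_itv.
by rewrite leb_itv/= lte_fin ab -EFinB -EFinM mulVf// gt_eqF.
Qed.

Lemma integral_box_eq a b x : 0 <= a -> a < b -> b <= x ->
  \int_ x (box a b) = 1%E.
Proof.
move=> a0 ab bx; rewrite integral_box// setIidl.
  by rewrite leb_itv/= lte_fin ab -EFinB -EFinM mulVf// gt_eqF// subr_gt0.
move=> y /=; rewrite !in_itv/= => /andP[ay yb].
by rewrite (le_trans a0 ay) (le_trans (ltW yb)).
Qed.

Lemma integral_box_ge0 a b x : a < b -> (0 <= \int_ x (box a b))%E.
Proof. by move=> ab; apply: integral_ge0 => y _; rewrite lee_fin box_ge0. Qed.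

(** The primitive of [`|f|] is nondecreasing, hence Borel, even when [f] is only
    Lebesgue measurable. *)
Lemma cesaro_abs_measurable (D : set R) f a :
  0 < a -> L0 setT f ->
  (forall x, \int_ x (fun t => `|f t|) \is a fin_num) ->
  (forall x, x < a -> \int_ x (fun t => `|f t|) = 0%E) ->
  L0 D (fine \o cesaro_abs f).
Proof.
move=> a0 mf ffin f0; apply: (@measurable_funTS _ _ (lebesgueType R)).
rewrite (_ : _ \o _ =
    fun x => (Num.max x a)^-1 * fine (\int_ x (fun t => `|f t|))); last first.
  apply/funext => x /=; rewrite /cesaro_abs/cesaro_op.
  rewrite fineM//; have [//|xa] := leP a x.
  by rewrite f0//= !mulr0.
apply: borel_lebesgue_measurable_fun => //; apply: measurable_funM.
  exact: measurable_inv_max.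
apply: nondecreasing_measurable => // x y xy.
apply: fine_le => //; apply: ge0_subset_integral => //=.
- exact: lebesgueType_itv.
- exact: lebesgueType_itv.
- apply/measurable_EFinP/measurableT_comp => //.
  exact: (@measurable_funTS _ _ (lebesgueType R)).
- by move=> z /=; rewrite !in_itv/= => /andP[-> /le_trans ->].
Qed.

End cesaro_integral.

(** * Series of boxes on consecutive intervals *)

Section box_series.
Context {R : realType} (t : nat -> R).
Hypothesis t_incr : forall k, t k < t k.+1.
Implicit Types (c : nat -> R) (x : R).

Local Notation box_ k := (box (t k) (t k.+1)).

(** A pointwise limit rather than a limit in norm: the supports are disjoint, so
    each point sees at most one nonzero term. *)
Definition box_series c x : R := limn (series (fun k => c k * box_ k x)).

Lemma incr_seq_le j k : (j <= k)%N -> t j <= t k.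
Proof.
by move=> jk; apply: (@nondecreasing_seqP _ _ t).1 => // n; exact/ltW.
Qed.

Lemma box_disjoint j k x : j != k -> box_ j x = 0 \/ box_ k x = 0.
Proof.
wlog jk : j k / (j < k)%N => [hwlog|_].
  rewrite neq_ltn => /orP[jk|kj].
    by apply: hwlog; rewrite ?(ltn_eqF jk).
  by apply/or_comm; apply: hwlog; rewrite ?(ltn_eqF kj).
rewrite /box !indicE.
have [xtj|tjx] := ltP x (t j.+1).
  right; rewrite memNset ?mulr0//= in_itv/=; apply/negP.
  rewrite negb_and -ltNge.
  by rewrite (lt_le_trans xtj)// incr_seq_le.
by left; rewrite memNset ?mulr0//= in_itv/= ltNge tjx andbF.
Qed.

Lemma box_index x : exists k0, forall k, k != k0 -> box_ k x = 0.
Proof.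
have [[k0 bk0]|/forallNP nz] := pselect (exists k, box_ k x <> 0).
  by exists k0 => k /(box_disjoint x) [].
by exists 0%N => k _; apply: contrapT; exact: nz.
Qed.

Lemma box_series_cvg c x :
  series (fun k => c k * box_ k x) n @[n --> \oo] --> box_series c x.
Proof.
have [k0 k0P] := box_index x.
have := @series_single_cvg _ (fun k => c k * box_ k x) k0.
have u0 k : k != k0 -> c k * box_ k x = 0 by move=> /k0P ->; rewrite mulr0.
by move=> /(_ u0) h; rewrite /box_series (cvg_lim _ h).
Qed.

Lemma measurable_box_series (D : set R) c : L0 D (box_series c).
Proof.
apply: (@measurable_funTS _ _ (lebesgueType R)).
apply: (@measurable_fun_cvg _ (lebesgueType R) _ _
  (fun n x => series (fun k => c k * box_ k x) n)) => [n|x _].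
  apply: (@measurable_sum _ (lebesgueType R)) => k.
  by apply: measurable_funM; [exact: measurable_cst|exact: measurable_box].
exact: box_series_cvg.
Qed.

Lemma norm_box_series c x :
  (`|box_series c x|%:E = \sum_(0 <= k <oo) (`|c k| * box_ k x)%:E)%E.
Proof.
have [k0 k0P] := box_index x.
have u0 k : k != k0 -> c k * box_ k x = 0 by move=> /k0P ->; rewrite mulr0.
have v0 k : k != k0 -> `|c k| * box_ k x = 0 by move=> /k0P ->; rewrite mulr0.
rewrite /box_series (cvg_lim _ (series_single_cvg u0))//.
rewrite normrM (ger0_norm (box_ge0 _ (t_incr k0))).
apply/esym/cvg_lim => //.
rewrite (_ : (fun n => _) =
    EFin \o series (fun k => `|c k| * box_ k x)); last first.
  by apply/funext => n /=; rewrite /series/= sumEFin.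
apply: cvg_EFin; first exact: nearW.
exact: (series_single_cvg v0).
Qed.

Lemma integral_norm_box_series c x :
  \int_ x (fun y => `|box_series c y|) =
  (\sum_(0 <= k <oo) `|c k|%:E * \int_ x (box_ k))%E.
Proof.
under eq_integral do rewrite norm_box_series.
rewrite integral_nneseries; last 3 first.
- exact: lebesgueType_itv.
- move=> k; apply/measurable_EFinP/measurable_funM; first exact: measurable_cst.
  exact: measurable_box.
- by move=> k y _; rewrite lee_fin mulr_ge0// box_ge0.
apply: eq_eseriesr => k _; under eq_integral do rewrite EFinM.
rewrite ge0_integralZl_EFin; first by [].
- exact: lebesgueType_itv.
- by move=> y _; rewrite lee_fin box_ge0.
- by apply/measurable_EFinP; exact: measurable_box.
- exact: normr_ge0.
Qed.

(** The first [n] boxes are moved to the left ends of their supports; all the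
    others are moved to the common point [t 0], at a cost that vanishes as [n]
    grows. *)
Lemma integral_norm_box_series_le c x n : cvgn (series (fun k => `|c k|)) ->
  (\int_ x (fun y => `|box_series c y|) <=
   (\sum_(0 <= k < n) `|c k| * (t k <= x)%R%:R +
    (limn (series (fun k => `|c k|)) - series (fun k => `|c k|) n)
      * (t 0 <= x)%R%:R)%:E)%E.
Proof.
move=> cc; rewrite integral_norm_box_series.
have pos k : (0 <= `|c k|%:E * \int_ x (box_ k))%E.
  by rewrite mule_ge0// integral_box_ge0.
apply: lime_le; first exact: is_cvg_nneseries.
near=> m.
have nm : (n <= m)%N by near: m; exists n.
apply: (@le_trans _ _ (\sum_(0 <= k < m) (`|c k| * (t k <= x)%R%:R)%:E)%E).
  by apply: lee_sum => k _; rewrite EFinM lee_wpmul2l// integral_box_le.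
rewrite sumEFin lee_fin (big_cat_nat (leq0n n) nm)//= lerD2l.
apply: (@le_trans _ _ ((series (fun k => `|c k|) m - series (fun k => `|c k|) n)
    * (t 0 <= x)%R%:R)).
  rewrite sub_series_geq// mulr_suml; apply: ler_sum => k _.
  rewrite ler_wpM2l//; have [tkx|//] := leP (t k) x.
  by rewrite (le_trans (incr_seq_le (leq0n k)) tkx).
rewrite ler_wpM2r// lerB//.
by apply: nondecreasing_cvgn_le => //; exact: nondecreasing_series.
Unshelve. all: by end_near. Qed.

(** To the right of all the supports only the total mass matters. This is the
    source of the lower estimate in the theorem: the Cesaro operator turns
    disjoint functions into functions that overlap completely there. *)
Lemma integral_norm_box_series_eq c x : 0 <= t 0 -> (forall k, t k <= x) ->
  cvgn (series (fun k => `|c k|)) ->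
  \int_ x (fun y => `|box_series c y|) = (limn (series (fun k => `|c k|)))%:E.
Proof.
move=> t0 tx cc; rewrite integral_norm_box_series -EFin_lim//.
congr (limn _); apply/funext => n /=; rewrite /series/= -sumEFin.
apply: eq_bigr => k _; rewrite integral_box_eq ?mule1//.
by rewrite (le_trans t0)// incr_seq_le.
Qed.

End box_series.

(** * Norm estimates in the Cesaro space *)

Section ideal_space.
Context {R : realType} (I : set R) (E : fspace R).
Hypothesis hE : is_banach_ideal_space I E.
Implicit Types (f g : R -> R) (c : nat -> R).

Lemma bi_dominated f g : L0 I f -> E g ->
  (forall x, I x -> `|f x| <= `|g x|) -> E f /\ fnorm E f <= fnorm E g.
Proof. by move=> mf Eg fg; apply: (bi_ideal hE) => //; exact: aeW. Qed.

Lemma bi_norm0 : fnorm E (cst 0) = 0.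
Proof.
rewrite (_ : cst 0 = (0 : R) \*o (cst 0 : R -> R)); last first.
  by apply/funext => x /=; rewrite mul0r.
by rewrite (bi_normZ hE) ?normr0 ?mul0r//; exact: bi_zero hE.
Qed.

Lemma bi_norm_ge0 f : E f -> 0 <= fnorm E f.
Proof.
move=> Ef; rewrite -bi_norm0; apply: (bi_dominated _ Ef _).2 => [|x _].
  exact: (bi_L0 hE (bi_zero hE)).
by rewrite normr0.
Qed.

Lemma bi_sum c (h : nat -> R -> R) n : (forall k, E (h k)) ->
  E (fun x => \sum_(0 <= k < n) c k * h k x) /\
  fnorm E (fun x => \sum_(0 <= k < n) c k * h k x) <=
    \sum_(0 <= k < n) `|c k| * fnorm E (h k).
Proof.
move=> Eh; elim: n => [|n [IH1 IH2]].
  rewrite (_ : (fun x => _) = cst 0); last first.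
    by apply/funext => x; rewrite big_geq.
  by rewrite bi_norm0 big_geq//; split => //; exact: bi_zero hE.
rewrite (_ : (fun x => _) =
    (fun x => \sum_(0 <= k < n) c k * h k x) \+ (c n \*o h n)); last first.
  by apply/funext => x /=; rewrite big_nat_recr.
have Ech : E (c n \*o h n) by exact: bi_scale hE _ _ (Eh n).
split; first exact: (bi_add hE).
rewrite big_nat_recr//= (le_trans (bi_normD hE IH1 Ech))// (bi_normZ hE)//.
by rewrite lerD2r.
Qed.

Lemma cesaro_dirac_mono a b : 0 < a -> a <= b -> E (cesaro_dirac a) ->
  E (cesaro_dirac b) /\ fnorm E (cesaro_dirac b) <= fnorm E (cesaro_dirac a).
Proof.
move=> a0 ab Ea; apply: bi_dominated => // [|x _].
  by apply: measurable_cesaro_dirac; exact: lt_le_trans ab.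
rewrite /cesaro_dirac !normrM ler_wpM2r// !normr_nat.
by have [bx|//] := leP b x; rewrite (le_trans ab bx).
Qed.

Section cesaro_of_box_series.
Variables (t : nat -> R) (b : R).
Hypotheses (t_incr : forall k, t k < t k.+1) (t0 : 0 < t 0).
Hypotheses (tb : forall k, t k <= b) (Et0 : E (cesaro_dirac (t 0))).

Local Notation phi a := (fnorm E (cesaro_dirac a)).
Local Notation F c x := (\int_ x (fun y => `|box_series t c y|)).
Local Notation tail c n :=
  (limn (series (fun k => `|c k|)) - series (fun k => `|c k|) n).

Let Et k : E (cesaro_dirac (t k)).
Proof. by apply: (cesaro_dirac_mono t0 _ Et0).1; exact: incr_seq_le. Qed.

Let tail_ge0 c n : cvgn (series (fun k => `|c k|)) -> 0 <= tail c n.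
Proof.
move=> cc; rewrite subr_ge0; apply: nondecreasing_cvgn_le => //.
exact: nondecreasing_series.
Qed.

Let F_ge0 c x : (0 <= F c x)%E.
Proof. by apply: integral_ge0 => y _; rewrite lee_fin. Qed.

Let F_fin c x : cvgn (series (fun k => `|c k|)) -> F c x \is a fin_num.
Proof.
move=> cc; rewrite ge0_fin_numE//.
by rewrite (le_lt_trans (integral_norm_box_series_le t_incr _ 0 cc))// ltry.
Qed.

Let F_eq0 c x : cvgn (series (fun k => `|c k|)) -> x < t 0 -> F c x = 0%E.
Proof.
move=> cc xt; apply/eqP; rewrite eq_le F_ge0 andbT.
rewrite (le_trans (integral_norm_box_series_le t_incr _ 0 cc))//.
by rewrite [t 0%N <= x]leNgt xt big_geq// mulr0 addr0.
Qed.

Let cesaroE c x : cvgn (series (fun k => `|c k|)) ->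
  (fine \o cesaro_abs (box_series t c)) x = x^-1 * fine (F c x).
Proof. by move=> cc; rewrite /= fineM//; exact: F_fin. Qed.

(* Only [x >= t 0] requires an argument: the left-hand side vanishes before
   [t 0], which disposes of the points where [x^-1] is not nonnegative. *)
Let cesaro_dominated c n x : cvgn (series (fun k => `|c k|)) ->
  `|(fine \o cesaro_abs (box_series t c)) x| <=
  `|((fun x => \sum_(0 <= k < n) `|c k| * cesaro_dirac (t k) x) \+
     (tail c n \*o cesaro_dirac (t 0))) x|.
Proof.
move=> cc; rewrite cesaroE//; have [xt|tx] := ltP x (t 0).
  by rewrite F_eq0// mulr0 normr0.
have x0 : 0 <= x^-1 by rewrite invr_ge0 (le_trans (ltW t0)).
rewrite ger0_norm ?mulr_ge0 ?fine_ge0// (le_trans _ (ler_norm _))//=.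
have := integral_norm_box_series_le t_incr x n cc.
rewrite -(fineK (F_fin x cc)) lee_fin => /(ler_wpM2l x0) /le_trans; apply.
rewrite mulrDr mulr_sumr mulrCA lerD//; last first.
  by rewrite [X in _ * X]mulrC.
by apply: ler_sum => k _; rewrite mulrCA [X in _ * X]mulrC.
Qed.

Let cesaro_L0 c : cvgn (series (fun k => `|c k|)) ->
  L0 I (fine \o cesaro_abs (box_series t c)).
Proof.
move=> cc; apply: (cesaro_abs_measurable t0) => [|x|x xt].
- exact: measurable_box_series.
- exact: F_fin.
- exact: F_eq0.
Qed.

Lemma box_series_cesaro_space c : cvgn (series (fun k => `|c k|)) ->
  cesaro_space I E (box_series t c).
Proof.
move=> cc; split; first exact: measurable_box_series.
  by apply: aeW => x _; rewrite fin_numM//; exact: F_fin.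
have [Es _] := bi_sum (fun k => `|c k|) 0 Et.
apply: (bi_dominated (cesaro_L0 cc) (bi_add hE Es
  (bi_scale hE (tail c 0) Et0)) _).1 => x _.
exact: cesaro_dominated.
Qed.

(** Beyond [b] the Cesaro transform is the total mass times that of the point
    mass at [b], so the ideal property bounds the norm from below. *)
Lemma cesaro_norm_box_series_ge c : cvgn (series (fun k => `|c k|)) ->
  limn (series (fun k => `|c k|)) * phi b <=
  fnorm (cesaro_space I E) (box_series t c).
Proof.
move=> cc; set l := limn _; have t0b := tb 0.
have l0 : 0 <= l.
  by have := tail_ge0 0 cc; rewrite /series/= big_geq// subr0.
have [Eb _] := cesaro_dirac_mono t0 t0b Et0.
rewrite -[X in X * _](ger0_norm l0) -(bi_normZ hE)//.
have [_ _ Es] := box_series_cesaro_space cc.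
apply: (bi_dominated _ Es _).2 => [|x Ix].
  exact: (bi_L0 hE (bi_scale hE _ Eb)).
rewrite cesaroE//= /cesaro_dirac; have [bx|xb] := leP b x.
  rewrite (integral_norm_box_series_eq t_incr (ltW t0) _ cc)/=.
    by rewrite mul1r mulrC.
  by move=> k; exact: le_trans bx.
by rewrite mul0r mulr0 normr0.
Qed.

(** The ideal property and the triangle inequality for the first [n] terms,
    followed by [n] to infinity in the remainder. *)
Lemma cesaro_norm_box_series_le c : cvgn (series (fun k => `|c k|)) ->
  cvgn (series (fun k => `|c k| * phi (t k))) ->
  fnorm (cesaro_space I E) (box_series t c) <=
  limn (series (fun k => `|c k| * phi (t k))).
Proof.
move=> cc cp; set l := limn _.
have H n :
    fnorm (cesaro_space I E) (box_series t c) <= l + tail c n * phi (t 0).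
  have [Es Esle] := bi_sum (fun k => `|c k|) n Et.
  have Et0' := bi_scale hE (tail c n) Et0.
  apply: (le_trans (bi_dominated (cesaro_L0 cc) (bi_add hE Es Et0')
    (fun x _ => cesaro_dominated n x cc)).2).
  rewrite (le_trans (bi_normD hE Es Et0'))// (bi_normZ hE)//.
  rewrite ger0_norm ?tail_ge0// lerD2r (le_trans Esle)//.
  apply: le_trans (nondecreasing_cvgn_le _ cp n); last first.
    by apply: nondecreasing_series => k _ _; rewrite mulr_ge0// bi_norm_ge0.
  by apply: ler_sum => k _; rewrite normr_id.
pose lc := limn (series (fun k => `|c k|)).
have cvH : l + tail c n * phi (t 0) @[n --> \oo] -->
    l + (lc - lc) * phi (t 0).
  apply: cvgD; first exact: cvg_cst.
  apply: cvgM; last exact: cvg_cst.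
  by apply: cvgB => //; exact: cvg_cst.
rewrite subrr mul0r addr0 in cvH.
rewrite -(cvg_lim _ cvH)//; apply: limr_ge; first by apply/cvg_ex; exists l.
by apply: nearW => n; exact: H.
Qed.

End cesaro_of_box_series.
End ideal_space.

Lemma cesaro_normN (R : realType) (I : set R) (X : fspace R) (f : R -> R) :
  fnorm (cesaro_space I X) (fun x => - f x) = fnorm (cesaro_space I X) f.
Proof.
congr (fnorm X (fine \o _)); apply/funext => x.
by congr (_ * _)%E; apply: eq_integral => y _; rewrite normrN.
Qed.

(** * Point masses in a nontrivial Cesaro space *)

(** Both intervals are exhausted, up to one point, by segments that stop
    strictly before the right end. The excluded point is the right end of the unit
    interval; the Cesaro transform of a point mass there vanishes almost
    everywhere. *)
Lemma unit_or_half_line_exhaustion (R : realType) (I : set R) :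
  I = `[0, 1]%classic \/ I = `[0, +oo[%classic ->
  exists u : nat -> R,
    [/\ forall n, 0 < u n,
        forall n, exists2 d, u n < d & `[0, d] `<=` I &
        forall x, I x -> x != 1 -> exists n, x <= u n].
Proof.
case=> ->.
  exists (fun n => 1 - n.+2%:R^-1); split => [n|n|x].
  - by rewrite subr_gt0 invf_lt1// ltr1n.
  - by exists 1 => //; rewrite ltrBlDr ltrDl invr_gt0.
  - rewrite /= in_itv/= => /andP[_]; rewrite le_eqVlt => /orP[->//|x1] _.
    exists (Num.truncn (1 - x)^-1); rewrite lerBrDr addrC -lerBrDr.
    rewrite invf_ple ?posrE ?subr_gt0//.
    by apply/ltW/(lt_le_trans (truncnS_gt _)); rewrite ler_nat.
exists (fun n => n.+1%:R); split => [n|n|x _ _].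
- by rewrite ltr0n.
- exists n.+2%:R; first by rewrite ltr_nat.
  by move=> y /=; rewrite !in_itv/= andbT => /andP[].
- by exists (Num.truncn x); exact/ltW/truncnS_gt.
Qed.

(** A nonzero [f] in the Cesaro space has positive mass [m] on some segment from
    [0] to [a] with [a] interior; beyond [a] its Cesaro transform is then at
    least [m] times that of the point mass at [a], which thus lies in [X]. *)
Lemma cesaro_dirac_mem (R : realType) (I : set R) (X : fspace R) :
  I = `[0, 1]%classic \/ I = `[0, +oo[%classic ->
  is_banach_ideal_space I X ->
  fspace_nontrivial I (cesaro_space I X) ->
  exists a d : R, [/\ 0 < a, a < d, `[0, d] `<=` I & X (cesaro_dirac a)].
Proof.
move=> hI hX [f [mf ffin Xf] fn0].
have mI : measurable (I : set (lebesgueType R)).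
  by case: hI => ->; exact: lebesgueType_itv.
have I0 x : I x -> 0 <= x.
  by case: hI => ->; rewrite /= in_itv/= => /andP[].
have [u [u0 ud uI]] := unit_or_half_line_exhaustion hI.
have [n fn] : exists n, (\int[leb R]_(t in `[0%R, u n]) `|f t|%:E)%E <> 0%E.
  apply: contrapT => /forallNP H; apply: fn0.
  have {}H n : \forall x \ae leb R, 0 <= x <= u n -> f x = 0.
    have [d und dI] := ud n.
    have := H n => /contrapT.
    have mfn : measurable_fun (`[0, u n] : set (lebesgueType R)) (EFin \o f).
      apply/measurable_EFinP; apply: measurable_funS mf => // x /=.
      rewrite in_itv/= => /andP[x0 xu]; apply: dI => /=.
      by rewrite in_itv/= x0 (le_trans xu)// ltW.
    move=> /(ae_eq_integral_abs (leb R) (lebesgueType_itv _) mfn).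
    apply: filterS => x + /andP[x0 xu].
    by rewrite /= in_itv/= x0 xu => /(_ isT) [].
  have := ae_foralln H; have := ae_neq (1 : R); rewrite /ae_on.
  apply: filterS2 => x x1 fx Ix; have [n xu] := uI _ Ix x1.
  by apply: (fx n); rewrite I0.
have [d und dI] := ud n; exists (u n), d; split => //.
set J := (\int[leb R]_(t in _) _)%E in fn.
have J0 : (0 < J)%E.
  rewrite lt_neqAle eq_sym; apply/andP.
  by split; [exact/eqP|exact: integral_ge0].
(* The mass may be infinite at this stage, so a finite part of it is used. *)
have [m m0 mJ] : exists2 m : R, 0 < m & (m%:E <= J)%E.
  move: J0; case: J {fn} => [r r0|_|//]; first by exists r.
  by exists 1; rewrite ?leey.
apply: (bi_ideal hX (measurable_cesaro_dirac _) (bi_scale hX m^-1 Xf) _).1 => //.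
move: ffin; rewrite /ae_on; apply: filterS => x + Ix => /(_ Ix) fx.
have x0 := I0 _ Ix.
rewrite /cesaro_dirac; have [ux|xu] := leP (u n) x; last first.
  by rewrite mul0r normr0.
rewrite mul1r ger0_norm ?invr_ge0// (le_trans _ (ler_norm _))//=.
rewrite ler_pdivlMl// -lee_fin fineK// mulrC EFinM /cesaro_abs/cesaro_op.
rewrite lee_wpmul2l// ?lee_fin ?invr_ge0// (le_trans mJ)//.
apply: ge0_subset_integral.
- exact: lebesgueType_itv.
- exact: lebesgueType_itv.
- apply/measurable_EFinP/measurableT_comp => //.
  apply: measurable_funS mf => // y; rewrite /= in_itv/= => /andP[y0 yx].
  case: hI Ix => ->; rewrite /= !in_itv/= y0//= => /andP[_].
  exact: le_trans.
- by move=> y _; rewrite lee_fin.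
- by move=> y; rewrite /= !in_itv/= => /andP[-> /le_trans ->].
Qed.

(** The transform of the point mass at [a] is positive on [[a, d]], a set of
    positive measure; this is where [a] must lie strictly inside [I]. *)
Lemma cesaro_dirac_norm_gt0 (R : realType) (I : set R) (X : fspace R)
    (a d : R) :
  is_banach_ideal_space I X -> 0 < a -> a < d -> `[0, d] `<=` I ->
  X (cesaro_dirac a) -> 0 < fnorm X (cesaro_dirac a).
Proof.
move=> hX a0 ad dI Xa; rewrite lt_neqAle eq_sym (bi_norm_ge0 hX Xa) andbT.
apply/eqP => /(bi_norm_eq0 hX Xa) [N [mN N0 IN]].
have : (leb R `[a, d] <= leb R N)%E.
  apply: le_measure; rewrite ?inE//; first exact: lebesgueType_itv.
  move=> x; rewrite /= in_itv/= => /andP[ax xd]; apply: IN => /= /(_ (dI _ _)).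
  rewrite /= in_itv/= xd (le_trans (ltW a0) ax) => /(_ isT) /eqP.
  by rewrite /cesaro_dirac ax mul1r invr_eq0 gt_eqF// (lt_le_trans a0).
by rewrite N0 leb_itv/= lte_fin ad -EFinB lee_fin leNgt subr_gt0 ad.
Qed.

(** * The copy of l1 *)

Theorem theorem4p5 (R : realType) (I : set R)
    (hI : I = `[0, 1]%classic \/ I = `[0, +oo[%classic)
    (X : fspace R) (hX : is_banach_function_space I X)
    (hCX : fspace_nontrivial I (cesaro_space I X)) :
  has_order_asymptotic_l1 I (cesaro_space I X).
Proof.
have hXi := hX.1; pose phi (a : R) := fnorm X (cesaro_dirac a).
have [a [d [a0 ad dI Xa]]] := cesaro_dirac_mem hI hXi hCX.
have Xh (x : R) : a <= x -> X (cesaro_dirac x).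
  by move=> ax; apply: (cesaro_dirac_mono hXi a0 ax Xa).1.
have phi_ni (x y : R) : a <= x -> x <= y -> phi y <= phi x.
  move=> ax xy.
  exact: (cesaro_dirac_mono hXi (lt_le_trans a0 ax) xy (Xh x ax)).2.
have [|b [t [bd at0 t_incr tb phi_cv]]] := @incr_seq_continuity _ phi a d ad.
  by move=> x y; rewrite in_itv/= => /andP[ax _] _; exact: phi_ni.
have t0 : 0 < t 0%N := lt_trans a0 at0.
have at_ k : a <= t k by rewrite (le_trans (ltW at0))// incr_seq_le.
have ab : a <= b by rewrite (le_trans (at_ 0%N))// ltW.
have tb_le k : t k <= b by rewrite ltW.
have phib : 0 < phi b.
  exact: (cesaro_dirac_norm_gt0 hXi (lt_le_trans a0 ab) bd dI (Xh b ab)).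
have phibt k : phi b <= phi (t k) by exact: phi_ni.
have phit k : 0 < phi (t k) by exact: lt_le_trans (phibt k).
(* The basis vectors are themselves box series, with a single nonzero
   coefficient, so that the estimates above apply to them. *)
pose delta (n k : nat) : R := (k == n)%:R / phi (t n).
have delta_series n g :
    series (fun k => delta n k * g k) m @[m --> \oo] --> g n / phi (t n).
  have := @series_single_cvg _ (fun k => delta n k * g k) n.
  rewrite /delta eqxx mul1r mulrC; apply => k /negbTE ->.
  by rewrite !mul0r.
pose f (n : nat) := box_series t (delta n).
have fE n x : f n x = box (t n) (t n.+1) x / phi (t n).
  exact/cvg_lim/delta_series.
have memC (c : nat -> R) : cvgn (series (fun k => `|c k|)) ->
    cesaro_space I X (box_series t c).
  by apply: box_series_cesaro_space => //; exact: Xh.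
(* The quotient tends to 1 by the choice of [b], but it may equal 1; the second
   factor makes [eps n] positive. *)
pose eps n := 1 - phi b / phi (t n) * (1 - n.+2%:R^-1).
have w01 n : 0 < 1 - n.+2%:R^-1 :> R /\ 1 - n.+2%:R^-1 < 1 :> R.
  by rewrite subr_gt0 invf_lt1 ?ltr1n// ltrBlDr ltrDl invr_gt0.
have q01 n : 0 < phi b / phi (t n) /\ phi b / phi (t n) <= 1.
  by rewrite divr_gt0// ler_pdivrMr// mul1r.
exists f, eps; split.
- move=> n; apply: memC; apply/cvg_ex; exists ((phi (t n))^-1).
  have := delta_series n (cst 1); rewrite mul1r; apply: cvg_trans.
  apply: near_eq_cvg; apply: nearW => m; apply: eq_bigr => k _ /=.
  by rewrite mulr1 ger0_norm// divr_ge0// ltW.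
- move=> m n mn; apply: aeW => x _.
  rewrite !fE.
  by have [->|->] := box_disjoint t_incr x mn; rewrite mul0r; [left|right].
- move=> n; have [w0 w1] := w01 n; have [q0 q1] := q01 n.
  rewrite subr_gt0 ltrBlDr ltrDl mulr_gt0// andbT.
  by rewrite (le_lt_trans _ w1)// ler_piMl// ltW.
- rewrite -[X in _ --> X](subrr 1); apply: cvgB; first exact: cvg_cst.
  rewrite -[X in _ --> X]mulr1; apply: cvgM.
    rewrite -[X in _ --> X](@divff _ (phi b)) ?gt_eqF//.
    by apply: cvgM; [exact: cvg_cst|apply: cvgV => //; rewrite gt_eqF].
  rewrite -[X in _ --> X]subr0; apply: cvgB; first exact: cvg_cst.
  by have := @cvg_harmonic R; rewrite -(cvg_shiftn 1);
    under eq_fun do rewrite addn1.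
move=> alpha acv; pose c k := alpha k / phi (t k).
have cE k : `|c k| = `|alpha k| / phi (t k).
  by rewrite normrM normfV (gtr0_norm (phit k)).
have ccv : cvgn (series (fun k => `|c k|)).
  apply: (@series_le_cvg _ _ (fun k => (phi b)^-1 * `|alpha k|)) => [k|k|k|].
  - exact: normr_ge0.
  - by rewrite mulr_ge0// invr_ge0 ltW.
  - by rewrite cE mulrC ler_wpM2r// lef_pV2 ?posrE.
  - exact: is_cvg_seriesZ.
have cphi : (fun k => `|c k| * phi (t k)) = (fun k => `|alpha k|).
  by apply/funext => k; rewrite cE mulfVK// gt_eqF.
exists (box_series t c).
  split; first exact: memC.
  (* A remainder of the series is again a box series. *)
  pose ct n k := if (k < n)%N then 0 else c k.
  have ctE n x : \sum_(0 <= k < n) alpha k * f k x - box_series t c x =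
      - box_series t (ct n) x.
    have := @series_tail_cvg _ _ _ n (@box_series_cvg _ _ t_incr c x).
    move=> /(cvg_lim (@norm_hausdorff _ _)) h.
    rewrite -opprB; congr (- _).
    rewrite (_ : \sum_(0 <= k < n) _ =
        series (fun k => c k * box (t k) (t k.+1) x) n); last first.
      by apply: eq_bigr => k _; rewrite fE mulrCA mulrC mulrA.
    rewrite -h /box_series; congr (limn (series _)); apply/funext => k.
    by rewrite /ct; case: ifP; rewrite ?mul0r.
  have ct_norm n :
      (fun k => `|ct n k|) = (fun k => if (k < n)%N then 0 else `|c k|).
    by apply/funext => k; rewrite /ct; case: ifP; rewrite ?normr0.
  have ct_cv n : cvgn (series (fun k => `|ct n k|)).
    by rewrite ct_norm; apply/cvg_ex; eexists; exact: series_tail_cvg ccv.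
  have ct_phi n : series (fun k => `|ct n k| * phi (t k)) m @[m --> \oo] -->
      limn (series (fun k => `|alpha k|)) - series (fun k => `|alpha k|) n.
    have := @series_tail_cvg _ _ _ n acv.
    rewrite (_ : (fun k => if _ then _ else _) =
        (fun k => `|ct n k| * phi (t k)))//.
    apply/funext => k; rewrite /ct; case: ifP; rewrite ?normr0 ?mul0r// => _.
    by rewrite cE mulfVK// gt_eqF.
  apply: (@squeeze_cvgr _ _ _ _ (cst 0) (fun n =>
      limn (series (fun k => `|alpha k|)) - series (fun k => `|alpha k|) n)).
  - apply: nearW => n /=; have [_ _ Xn] := memC (ct n) (ct_cv n).
    rewrite (_ : fnorm _ _ =
        fnorm (cesaro_space I X) (box_series t (ct n))); last first.
      rewrite -[RHS]cesaro_normN; congr (fnorm X (fine \o cesaro_abs _)).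
      by apply/funext => x; exact: ctE.
    rewrite (bi_norm_ge0 hXi Xn)/=.
    rewrite -(cvg_lim (@norm_hausdorff _ _) (ct_phi n)).
    apply: (cesaro_norm_box_series_le hXi t_incr t0 (Xh _ (at_ 0%N)) (ct_cv n)).
    by apply/cvg_ex; eexists; exact: ct_phi.
  - exact: cvg_cst.
  - rewrite -[X in _ --> X](subrr (limn (series (fun k => `|alpha k|)))).
    by apply: cvgB; [exact: cvg_cst|exact: acv].
apply/andP; split; last first.
  have := cesaro_norm_box_series_le hXi t_incr t0 (Xh _ (at_ 0%N)) ccv.
  by rewrite cphi; apply.
have := cesaro_norm_box_series_ge hXi t_incr t0 tb_le (Xh _ (at_ 0%N)) ccv.
apply: le_trans.
rewrite mulrC (_ : _ * _ =
    limn (series (fun k => phi b * `|c k|))); last first.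
  exact/esym/lim_seriesZ.
have epsE k : (1 - eps k) * `|alpha k| <= phi b * `|c k|.
  have [_ w1] := w01 k; have [q0 _] := q01 k.
  rewrite subKr cE mulrA [leRHS]mulrAC ler_wpM2r//.
  by rewrite ler_piMr// ltW.
apply: lim_series_le => //.
- apply: (@series_le_cvg _ _ (fun k => phi b * `|c k|)) => [k|k|//|].
  + have [w0 _] := w01 k; have [q0 _] := q01 k.
    by rewrite subKr mulr_ge0// ltW// mulr_gt0.
  + by rewrite mulr_ge0// ltW.
  + exact: is_cvg_seriesZ.
- exact: is_cvg_seriesZ.
Qed.
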